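(* Let $A\in\mathbb{R}^{n\times n}$ be symmetric positive semi-definite and let $Q\in\mathbb{R}^{n\times k}$ have orthonormal columns ($Q^\top Q=I_k$, $k\le n$). Then for every $i=1,\ldots,k$, \[ \lambda_i(A)\;\ge\;\lambda_i\bigl(AQ(Q^\top AQ)^{\dagger}(AQ)^\top\bigr)\;\ge\;\sigma_i(AQ)\;\ge\;\lambda_i(Q^\top AQ). \]
   Context: For a symmetric matrix $B$, $\lambda_1(B)\ge\lambda_2(B)\ge\cdots$ denote its eigenvalues in non-increasing order; for any matrix $B$, $\sigma_1(B)\ge\sigma_2(B)\ge\cdots\ge0$ denote its singular values in non-increasing order. $B^{\dagger}$ is the Moore–Penrose pseudoinverse. The matrix $A\langle Q\rangle:=AQ(Q^\top AQ)^{\dagger}(AQ)^\top$ is the Nyström approximation of $A$ with respect to $Q$; the three quantities $\lambda_i(A\langle Q\rangle)$, $\sigma_i(AQ)$, $\lambda_i(Q^\top AQ)$ are the eigenvalue estimates produced by the Nyström, SVD-extract, and Rayleigh–Ritz methods respectively. In the paper $\operatorname{span}(Q)$ is intended to approximate the span of the eigenvectors of $A$ for its $k$ largest eigenvalues, but no quantitative condition on this is imposed. *)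

(* Defs.v *)
From HB Require Import structures.
From mathcomp Require Import all_boot all_order all_algebra.
From mathcomp Require Import boolp classical_sets reals.
Set Implicit Arguments. Unset Strict Implicit. Unset Printing Implicit Defensive.
Import Order.TTheory GRing.Theory Num.Theory.
Local Open Scope ring_scope.

Section Defs.
Variable R : realType.

Definition is_eigseq (n : nat) (B : 'M[R]_n) (s : seq R) : Prop :=
  [/\ size s = n, sorted (fun x y => y <= x) s
    & char_poly B = \prod_(x <- s) ('X - x%:P)].

(* The non-increasing eigenvalue list of B (chosen classically; unique when
   it exists, which is the case for symmetric real B). *)
Definition eigvals (n : nat) (B : 'M[R]_n) : seq R :=
  xget (nseq n 0) (is_eigseq B).

(* lambda B i = lambda_{i+1}(B)  (0-based index) *)
Definition lambda (n : nat) (B : 'M[R]_n) (i : nat) : R := nth 0 (eigvals B) i.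

(* singular values: sigma M i = sigma_{i+1}(M) = sqrt(lambda_{i+1}(M^T M)),
   for M : 'M_(m,k) (used with k <= m). *)
Definition sing_val (m k : nat) (M : 'M[R]_(m, k)) (i : nat) : R :=
  Num.sqrt (lambda (M^T *m M) i).

Definition is_mp_pinv (m p : nat) (M : 'M[R]_(m, p)) (X : 'M[R]_(p, m)) : Prop :=
  [/\ M *m X *m M = M, X *m M *m X = X,
      (M *m X)^T = M *m X & (X *m M)^T = X *m M].

Definition mp_pinv (m p : nat) (M : 'M[R]_(m, p)) : 'M[R]_(p, m) :=
  xget 0 (is_mp_pinv M).

Definition nystrom (n k : nat) (A : 'M[R]_n) (Q : 'M[R]_(n, k)) : 'M[R]_n :=
  (A *m Q) *m mp_pinv (Q^T *m A *m Q) *m (A *m Q)^T.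

Definition psd (n : nat) (A : 'M[R]_n) : Prop :=
  A^T = A /\ forall x : 'cV[R]_n, 0 <= (x^T *m A *m x) 0 0.

End Defs.

(* Main.v *)
(* Everything reduces to one comparison principle (lambda_compress_le): if Q is
   an isometry and C <= Q^T B Q as quadratic forms, then lambda_i(C) <=
   lambda_i(B).  Put N = nystrom A Q.  Then N is positive semi-definite and
   - A - N = (1 - P)^T A (1 - P) >= 0 with P = Q (Q^T A Q)^+ Q^T A;
   - N Q = A Q, so (A Q)^T (A Q) = Q^T N^2 Q is a compression of N^2;
   - (Q^T A Q)^2 = (A Q)^T Q Q^T (A Q) <= (A Q)^T (A Q), since Q Q^T is a
     projection.
   The last two are turned into the inequalities with sigma_i by
   lambda_i(B^2) = lambda_i(B)^2 for positive semi-definite B. *)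
Require Import Defs.
From HB Require Import structures.
From mathcomp Require Import all_boot all_order all_fingroup all_algebra.
From mathcomp Require Import complex ring.
From mathcomp Require Import boolp classical_sets reals.
Import Order.TTheory GRing.Theory Num.Theory.
Local Open Scope ring_scope.

Set Implicit Arguments.
Unset Strict Implicit.
Unset Printing Implicit Defensive.

(** * Spectral theorem for real symmetric matrices *)

Section SpectralTheorem.
Variable R : realType.

Lemma col_sqE n (x : 'cV[R]_n) : (x^T *m x) 0 0 = \sum_i x i 0 ^+ 2.
Proof. by rewrite mxE; apply: eq_bigr => i _; rewrite mxE expr2. Qed.

Lemma col_sq_ge0 n (x : 'cV[R]_n) : 0 <= (x^T *m x) 0 0.
Proof. by rewrite col_sqE sumr_ge0 // => i _; rewrite sqr_ge0. Qed.

Lemma col_sq_eq0 n (x : 'cV[R]_n) : ((x^T *m x) 0 0 == 0) = (x == 0).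
Proof.
apply/idP/eqP => [|->]; last by rewrite mulmx0 mxE.
rewrite col_sqE psumr_eq0 => [/allP x0|i _]; last exact: sqr_ge0.
apply/colP => i; rewrite mxE; apply/eqP.
by rewrite -sqrf_eq0; apply: x0; rewrite mem_index_enum.
Qed.

Lemma gram_eq0 m n (M : 'M[R]_(m, n)) : M^T *m M = 0 -> M = 0.
Proof.
move=> M0; apply/matrixP => i j.
suff /eqP/colP/(_ i) : col j M == 0 by rewrite !mxE.
rewrite -col_sq_eq0; have /matrixP/(_ j j) := M0; rewrite !mxE => M0j.
by apply/eqP; rewrite -[RHS]M0j; apply: eq_bigr => k _; rewrite !mxE.
Qed.

(** Viewed over the complex numbers, [A] is Hermitian, so its spectrum is real; a real root of the
    complexified characteristic polynomial is a root of the original one. *)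
Lemma sym_real_eigenvalue n (A : 'M[R]_n) : (0 < n)%N -> A^T = A ->
  exists a, eigenvalue A a.
Proof.
case: n A => // n A _ symA; pose B := map_mx (real_complex R) A.
have herB : B \is hermsymmx.
  apply: realsym_hermsym.
    apply/is_hermitianmxP/matrixP => i j; rewrite expr0 scale1r !mxE.
    by rewrite -{1}symA mxE.
  by apply/mxOverP => i j; rewrite mxE; apply/complex_realP; eexists.
have /mxOverP/(_ 0 0)/complex_realP[a Ea] := hermitian_spectral_diag_real herB.
have /orthomx_spectralP EB := hermitian_normalmx herB.
have Pu := spectral_unit B; set P := spectralmx B in EB Pu.
exists a; rewrite eigenvalue_root_char -(fmorph_root (real_complex R)).
rewrite map_char_poly -eigenvalue_root_char; apply/eigenvalueP.
(* The rows of [P] are left eigenvectors because [B] is P^-1 D P; row 0 is nonzero because [P] is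
   invertible. *)
exists (row 0 P).
  rewrite -[map_mx _ _]/B {1}EB -row_mul !mulmxA mulmxV // mul1mx.
  rewrite mul_diag_mx; apply/rowP => j; rewrite !mxE.
  by rewrite /= -Ea.
apply/eqP => P0; have := congr1 (fun M => row 0 M 0 0) (mulmxV Pu).
by rewrite row_mul P0 mul0mx !mxE eqxx => /esym/eqP; rewrite oner_eq0.
Qed.

(** Two distinct vectors of equal length are swapped by the reflection in the hyperplane orthogonal
    to their difference [w]. *)
Lemma householder n (e v : 'cV[R]_n) : e^T *m e = 1%:M -> v^T *m v = 1%:M ->
  exists H : 'M[R]_n, [/\ H^T = H, H *m H = 1%:M & H *m e = v].
Proof.
move=> e1 v1; have [<-|nev] := eqVneq e v.
  by exists 1%:M; rewrite trmx1 !mul1mx.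
pose w := e - v; pose s := (w^T *m w) 0 0.
have s0 : s != 0 by rewrite col_sq_eq0 subr_eq0.
have ww : w^T *m w = s%:M by rewrite [LHS]mx11_scalar.
(* Both sides equal 2 - 2 v^T e; hence the reflection subtracts exactly [w] from [e]. *)
have sE : s = 2 * (w^T *m e) 0 0.
  have vtv : (v^T *m v) 0 0 = 1 by rewrite v1 mxE.
  have ete : (e^T *m e) 0 0 = 1 by rewrite e1 mxE.
  have etv : (e^T *m v) 0 0 = (v^T *m e) 0 0.
    by rewrite -[e^T *m v]trmxK trmx_mul trmxK mxE.
  have wT : w^T = e^T - v^T by rewrite linearB.
  rewrite /s wT /w mulmxBr !mulmxBl; move: vtv ete etv.
  move: (v^T *m v) (e^T *m e) (e^T *m v) (v^T *m e) => a b c d.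
  by rewrite !mxE => -> -> ->; ring.
exists (1%:M - (2 / s) *: (w *m w^T)); split.
- by rewrite linearB /= linearZ /= trmx1 trmx_mul trmxK.
- rewrite mulmxBl mul1mx mulmxBr mulmx1 -scalemxAl -scalemxAr.
  rewrite mulmxA -[w *m w^T *m w]mulmxA ww mul_mx_scalar -scalemxAl !scalerA.
  by rewrite divfK // mulr_natr mulr2n scalerDl opprB addrK subrK.
- rewrite mulmxBl mul1mx -scalemxAl -mulmxA [w^T *m e]mx11_scalar mul_mx_scalar.
  by rewrite scalerA mulrAC -sE divff // scale1r /w opprB addrC subrK.
Qed.

Lemma sym_eig_unit n (A : 'M[R]_n) : (0 < n)%N -> A^T = A ->
  exists a (v : 'cV[R]_n), v^T *m v = 1%:M /\ A *m v = a *: v.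
Proof.
move=> n0 symA; have [a /eigenvalueP[u uA u0]] := sym_real_eigenvalue n0 symA.
pose s := (u *m u^T) 0 0.
have s0 : 0 < s.
  have -> : s = (u^T^T *m u^T) 0 0 by rewrite trmxK.
  rewrite lt_neqAle eq_sym col_sq_ge0 col_sq_eq0 andbT.
  by apply: contra_neq u0 => uT0; rewrite -[u]trmxK uT0 trmx0.
exists a, ((Num.sqrt s)^-1 *: u^T); split.
  have -> c : (c *: u^T)^T = c *: u by rewrite linearZ /= trmxK.
  rewrite -scalemxAl -scalemxAr scalerA -invfM -expr2.
  rewrite sqr_sqrtr ?ltW // [u *m _]mx11_scalar -/s -scalemx1 scalerA.
  by rewrite mulVf ?scale1r // gt_eqF.
rewrite -scalemxAr.
have -> : A *m u^T = a *: u^T by rewrite -{1}symA -trmx_mul uA linearZ.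
by rewrite !scalerA mulrC.
Qed.

(** Deflation: a reflection [H] sends the first basis vector [e] to a unit eigenvector. Then H A H
    has first column [a *: e], by symmetry also the matching first row, and induction applies to the
    remaining block. *)
Lemma real_spectral n (A : 'M[R]_n) : A^T = A ->
  exists (U : 'M[R]_n) (d : 'rV[R]_n),
    U^T *m U = 1%:M /\ A = U *m diag_mx d *m U^T.
Proof.
elim: n A => [|n IH] A symA.
  by exists 1%:M, 0; split; apply/matrixP => -[].
have [a [v [v1 Av]]] := sym_eig_unit (ltn0Sn n) symA.
pose e : 'cV[R]_(1 + n) := col_mx 1%:M 0.
have e1 : e^T *m e = 1%:M.
  by rewrite tr_col_mx mul_row_col trmx0 mul0mx addr0 trmx1 mul1mx.
have [H [symH HH He]] := householder e1 v1.
pose B : 'M[R]_(1 + n) := H *m A *m H.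
have symB : B^T = B by rewrite !trmx_mul symH symA mulmxA.
have Be : B *m e = a *: e.
  by rewrite -mulmxA He -mulmxA Av -scalemxAr -He mulmxA HH mul1mx.
have EB : B = block_mx a%:M 0 0 (drsubmx B).
  move: Be; rewrite -{1}[B]submxK mul_block_col !mulmx1 !mulmx0 !addr0.
  rewrite scale_col_mx scaler0 scalemx1 => /eq_col_mx[ul dl].
  rewrite -[LHS]submxK ul dl; congr block_mx.
  by rewrite -{1}symB -trmx_dlsub dl trmx0.
have [|U [d [U1 EU]]] := IH (drsubmx B); first by rewrite trmx_drsub symB.
pose V : 'M[R]_(1 + n) := block_mx 1%:M 0 0 U.
have VT : V^T = block_mx 1%:M 0 0 U^T by rewrite tr_block_mx trmx1 !trmx0.
have VV : V^T *m V = 1%:M.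
  rewrite VT /V mulmx_block !mulmx1 !mulmx0 !mul0mx !addr0 add0r U1.
  by rewrite -scalar_mx_block.
have VdV : V *m diag_mx (row_mx a%:M d) *m V^T = B.
  rewrite diag_mx_row VT /V !mulmx_block !mulmx0 !mul0mx !mul1mx !addr0 !add0r.
  rewrite mulmx1 EB EU; congr block_mx; rewrite ?mul0mx //.
  by apply/matrixP => i j; rewrite !ord1 !mxE eqxx.
exists (H *m V), (row_mx a%:M d); split.
  by rewrite trmx_mul symH mulmxA -[_ *m H *m H]mulmxA HH mulmx1 VV.
transitivity (H *m B *m H).
  by rewrite /B !mulmxA HH mul1mx -mulmxA HH mulmx1.
by rewrite -VdV trmx_mul symH !mulmxA.
Qed.

End SpectralTheorem.

(** * Ordered eigenvalues and the comparison principle *)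

Section Eigenvalues.
Variable R : realType.

Lemma eigseq_uniq n (B : 'M[R]_n) s t : is_eigseq B s -> is_eigseq B t -> s = t.
Proof.
move=> [_ srt_s Bs] [_ srt_t Bt]; apply: (sorted_eq _ _ srt_s srt_t).
- by move=> y x z /= yx zy; apply: le_trans zy yx.
- by move=> x y /=; rewrite andbC; apply: le_anti.
- by apply: prod_XsubC_eq; rewrite -Bs -Bt.
Qed.

Lemma eigvalsE n (B : 'M[R]_n) s : is_eigseq B s -> eigvals B = s.
Proof.
by move=> Bs; apply: (eigseq_uniq (B := B)) => //; apply: xgetPex; exists s.
Qed.

Lemma char_poly_conj n (U V B : 'M[R]_n) : U *m V = 1%:M ->
  char_poly (U *m B *m V) = char_poly B.
Proof.
move=> UV; have UVp : map_mx polyC U *m map_mx polyC V = 1%:M.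
  by rewrite -map_mxM UV map_mx1.
rewrite /char_poly; have -> : char_poly_mx (U *m B *m V) =
    map_mx polyC U *m char_poly_mx B *m map_mx polyC V.
  rewrite /char_poly_mx mulmxBr mulmxBl !map_mxM; congr (_ - _).
  by rewrite mul_mx_scalar -scalemxAl UVp scalemx1.
by rewrite !det_mulmx mulrAC -det_mulmx UVp det1 mul1r.
Qed.

(** This turns the classically chosen [lambda] into something computable: any orthogonal
    diagonalisation with sorted diagonal exhibits it. *)
Lemma lambda_conj_diag n (U : 'M[R]_n) (d : 'rV[R]_n) (i : 'I_n) :
  U^T *m U = 1%:M -> (forall j k : 'I_n, (j <= k)%N -> d 0 k <= d 0 j) ->
  lambda (U *m diag_mx d *m U^T) i = d 0 i.
Proof.
move=> U1 dS; rewrite /lambda (@eigvalsE _ _ [seq d 0 j | j <- enum 'I_n]).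
  by rewrite (nth_map i) ?size_enum_ord // nth_ord_enum.
split.
- by rewrite size_map size_enum_ord.
- case: n U d i U1 dS => [|n] U d i U1 dS; first by case: i.
  rewrite sorted_map; apply: (sub_sorted _ (e := relpre val leq)).
    by move=> j k; apply: dS.
  by rewrite -sorted_map val_enum_ord iota_sorted.
- rewrite char_poly_conj; last exact: mulmx1C.
  rewrite char_poly_trig ?diag_mx_is_trig // big_map big_enum /=.
  by apply: eq_bigr => j _; rewrite mxE eqxx.
Qed.

Lemma real_spectral_sorted n (A : 'M[R]_n) : A^T = A ->
  exists (U : 'M[R]_n) (d : 'rV[R]_n),
    [/\ U^T *m U = 1%:M, A = U *m diag_mx d *m U^T &
      forall j k : 'I_n, (j <= k)%N -> d 0 k <= d 0 j].
Proof.
move=> /real_spectral[U [d [U1 ->]]].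
pose r := (fun x y : R => y <= x).
pose t := [tuple d 0 j | j < n]; pose s := sort r t.
(* The permutation [p] that sorts the diagonal is also applied to the columns of [U]. *)
have /tuple_permP[p Es] : perm_eq s t by rewrite perm_sort.
have sn : size s = n by rewrite size_sort size_tuple.
have sE (j : 'I_n) : nth 0 s j = d 0 (p j).
  by rewrite Es -tnth_nth !tnth_mktuple.
exists (\matrix_(i, j) U i (p j)), (\row_j d 0 (p j)); split.
- apply/matrixP => i j; have /matrixP/(_ (p i) (p j)) := U1.
  rewrite !mxE (inj_eq perm_inj) => <-.
  by apply: eq_bigr => k _; rewrite !mxE.
- apply/matrixP => i k; rewrite !mul_mx_diag !mxE (reindex_inj (@perm_inj _ p)).
  by apply: eq_bigr => j _; rewrite !mxE.
- move=> j k jk; rewrite !mxE -!sE.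
  have srt : sorted r s by apply: sort_sorted => x y; apply: le_total.
  apply: (sorted_leq_nth _ _ _ srt); rewrite ?inE ?sn //.
    by move=> y x z /= yx zy; apply: le_trans zy yx.
  exact: lexx.
Qed.

Lemma spectral_lambda n (A : 'M[R]_n) : A^T = A ->
  exists U : 'M[R]_n, [/\ U^T *m U = 1%:M,
    A = U *m diag_mx (\row_(j < n) lambda A j) *m U^T &
    forall j k : 'I_n, (j <= k)%N -> lambda A k <= lambda A j].
Proof.
move=> /real_spectral_sorted[U [d [U1 EA dS]]].
have lE (j : 'I_n) : lambda A j = d 0 j by rewrite EA lambda_conj_diag.
exists U; split=> // [|j k jk]; last by rewrite !lE dS.
rewrite {1}EA; congr (_ *m diag_mx _ *m _).
by apply/rowP => j; rewrite mxE lE.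
Qed.

Lemma quad_conj_diag n m (U : 'M[R]_(m, n)) (d : 'rV[R]_n) (x : 'cV[R]_m) :
  (x^T *m (U *m diag_mx d *m U^T) *m x) 0 0 =
  \sum_j d 0 j * (U^T *m x) j 0 ^+ 2.
Proof.
have -> : x^T *m (U *m diag_mx d *m U^T) *m x =
    (U^T *m x)^T *m diag_mx d *m (U^T *m x).
  by rewrite trmx_mul trmxK !mulmxA.
rewrite mul_mx_diag mxE; apply: eq_bigr => j _.
by rewrite !mxE expr2 mulrCA mulrA.
Qed.

(* The m - 1 linear conditions on z are the rows r != i of a square matrix K
   whose row i vanishes; z is taken in the kernel of K. *)
Lemma ex_triangular_vector n m (T : 'M[R]_(n, m)) (i : 'I_m) :
  exists z : 'cV[R]_m, [/\ z != 0, forall j : 'I_m, (i < j)%N -> z j 0 = 0 &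
    forall j : 'I_n, (j < i)%N -> (T *m z) j 0 = 0].
Proof.
pose K : 'M[R]_m := \matrix_(r, c)
  if (i < r)%N then (r == c)%:R
  else if (r < i)%N then oapp (fun j : 'I_n => T j c) 0 (insub (r : nat))
  else 0.
have : ~~ row_free K^T.
  rewrite row_free_unit unitmx_tr; apply/negP => /mulmxV.
  move=> /(congr1 (fun M => row i M 0 i)); rewrite row_mul.
  have -> : row i K = 0.
    by apply/rowP => c; rewrite !mxE ltnn.
  by rewrite mul0mx !mxE eqxx => /esym/eqP; rewrite oner_eq0.
rewrite -kermx_eq0 => /rowV0Pn[u /sub_kermxP uK u0].
have Kz r : (K *m u^T) r 0 = 0.
  by rewrite -[K *m _]trmxK trmx_mul trmxK uK !mxE.
exists u^T; split.
- by apply: contra_neq u0 => uT0; rewrite -[u]trmxK uT0 trmx0.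
- move=> j ij; have := Kz j; rewrite mxE (bigD1 j) //= big1 => [|c cj].
    by rewrite mxE ij eqxx mul1r addr0.
  by rewrite mxE ij eq_sym (negPf cj) mul0r.
- move=> j ji; have jm : (j < m)%N := ltn_trans ji (ltn_ord i).
  rewrite -(Kz (Ordinal jm)) [in LHS]mxE [in RHS]mxE.
  apply: eq_bigr => c _; rewrite [K _ _]mxE /= ltnNge ltnW //= ji.
  rewrite (insubT (fun r => r < n)%N (ltn_ord j)) /=.
  by congr (T _ _ * _); apply: val_inj.
Qed.

(** Courant-Fischer dimension count: some nonzero vector lies in the span of the eigenvectors 0..i
    of [C] while its image under [Q] is orthogonal to the eigenvectors 0..i-1 of [B]. Its two
    Rayleigh quotients separate the eigenvalues. *)
Lemma lambda_compress_le n m (B : 'M[R]_n) (C : 'M[R]_m) (Q : 'M[R]_(n, m))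
    (i : nat) :
  B^T = B -> C^T = C -> Q^T *m Q = 1%:M ->
  (forall x : 'cV[R]_m,
    (x^T *m C *m x) 0 0 <= ((Q *m x)^T *m B *m (Q *m x)) 0 0) ->
  (i < m)%N -> lambda C i <= lambda B i.
Proof.
move=> symB symC Q1 leCB im; have mn := mulmx1_min Q1.
have [U [U1 EC decC]] := spectral_lambda symC.
have [V [V1 EB decB]] := spectral_lambda symB.
(* This matrix is [Q] read in the eigenbases of [C] and [B]: [z] and [y] are the coordinates of the
   vector and of its image. *)
have [z [z0 zi Tzi]] := ex_triangular_vector (V^T *m Q *m U) (Ordinal im).
set y := _ *m z in Tzi.
have yy : (y^T *m y) 0 0 = (z^T *m z) 0 0.
  rewrite /y !trmx_mul trmxK !mulmxA; congr ((_ *m _) 0 0).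
  rewrite -[_ *m V *m V^T]mulmxA (mulmx1C V1) mulmx1.
  by rewrite -[_ *m Q^T *m Q]mulmxA Q1 mulmx1 -mulmxA U1 mulmx1.
have zz : 0 < (z^T *m z) 0 0.
  by rewrite lt_neqAle eq_sym col_sq_eq0 z0 col_sq_ge0.
have := leCB (U *m z); rewrite {1}EC {1}EB !quad_conj_diag.
rewrite mulmxA U1 mul1mx !mulmxA -/y => leCB_z.
(* Scaling by the common squared length of [z] and [y] lets both sides be compared with the
   quadratic forms term by term. *)
rewrite -(ler_pM2r zz) -{2}yy !col_sqE !mulr_sumr.
apply: le_trans (le_trans leCB_z _); apply: ler_sum => j _; rewrite mxE.
- have [ji|ij] := leqP j i; last by rewrite zi // expr0n /= !mulr0.
  by rewrite ler_wpM2r ?sqr_ge0 // (decC j (Ordinal im)).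
- have [ij|ji] := leqP i j; last by rewrite Tzi // expr0n /= !mulr0.
  by rewrite ler_wpM2r ?sqr_ge0 // (decB (Ordinal (leq_trans im mn)) j).
Qed.

Lemma psd_lambda_ge0 n (A : 'M[R]_n) (i : nat) : psd A -> (i < n)%N ->
  0 <= lambda A i.
Proof.
move=> [symA posA] ilt; have [U [U1 EA _]] := spectral_lambda symA.
have := posA (U *m delta_mx (Ordinal ilt) 0).
rewrite {1}EA quad_conj_diag mulmxA U1 mul1mx (bigD1 (Ordinal ilt)) //=.
rewrite big1 => [|j ji]; last by rewrite !mxE (negPf ji) expr0n /= mulr0.
by rewrite !mxE !eqxx expr1n mulr1 addr0.
Qed.

(** Squaring keeps the eigenvalues in non-increasing order because they are nonnegative. *)
Lemma lambda_sqr n (A : 'M[R]_n) (i : nat) : psd A -> (i < n)%N ->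
  lambda (A *m A) i = lambda A i ^+ 2.
Proof.
move=> psdA ilt; have [U [U1 EA decA]] := spectral_lambda psdA.1.
set d := \row_j _ in EA.
have -> : A *m A = U *m diag_mx (\row_j (d 0 j * d 0 j)) *m U^T.
  by rewrite -mulmx_diag {1 2}EA !mulmxA -[_ *m U^T *m U]mulmxA U1 mulmx1.
rewrite (@lambda_conj_diag _ U _ (Ordinal ilt)) //.
  by rewrite !mxE expr2.
move=> j k jk; rewrite !mxE.
by rewrite ler_pM ?psd_lambda_ge0 ?decA.
Qed.

End Eigenvalues.

(** * Pseudoinverses and the Nyström approximation *)

Section Nystrom.
Variable R : realType.

Lemma psd_congr m n (A : 'M[R]_n) (Z : 'M[R]_(n, m)) :
  psd A -> psd (Z^T *m A *m Z).
Proof.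
move=> [symA posA]; split; first by rewrite !trmx_mul trmxK symA mulmxA.
by move=> x; have := posA (Z *m x); rewrite trmx_mul !mulmxA.
Qed.

Lemma psd_gram n (A : 'M[R]_n) : psd A -> exists G : 'M[R]_n, A = G^T *m G.
Proof.
move=> psdA; have [U [U1 EA _]] := spectral_lambda psdA.1.
exists (diag_mx (\row_j Num.sqrt (lambda A j)) *m U^T).
rewrite trmx_mul trmxK tr_diag_mx mulmxA -[U *m _ *m _]mulmxA mulmx_diag.
rewrite {1}EA; congr (_ *m diag_mx _ *m _); apply/rowP => j.
by rewrite !mxE -expr2 sqr_sqrtr // psd_lambda_ge0.
Qed.

(** With A = G^T G, the hypothesis says that the Gram matrix of G Z vanishes, so G Z = 0. *)
Lemma psd_congr_eq0 m n (A : 'M[R]_n) (Z : 'M[R]_(n, m)) :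
  psd A -> Z^T *m A *m Z = 0 -> A *m Z = 0.
Proof.
move=> /psd_gram[G ->] ZGZ.
rewrite -mulmxA (@gram_eq0 _ _ _ (G *m Z)) ?mulmx0 //.
by rewrite trmx_mul !mulmxA in ZGZ *.
Qed.

(** M X and M Y are both the orthogonal projection onto the range of [M]; dually X M = Y M. Then X =
    XMX = YMX = YMY = Y. *)
Lemma mp_pinv_uniq m p (M : 'M[R]_(m, p)) X Y :
  is_mp_pinv M X -> is_mp_pinv M Y -> X = Y.
Proof.
move=> [MXM XMX tMX tXM] [MYM YMY tMY tYM].
have MXY : M *m X = M *m Y.
  by rewrite -tMX -{1}MYM -[M *m Y *m M *m X]mulmxA trmx_mul tMX tMY mulmxA MXM.
have XYM : X *m M = Y *m M.
  rewrite -tXM -{1}MYM -mulmxA mulmxA trmx_mul tYM tXM -mulmxA.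
  by rewrite [M *m (X *m M)]mulmxA MXM.
by rewrite -XMX XYM -mulmxA MXY mulmxA YMY.
Qed.

Lemma sym_mp_pinv_exists n (M : 'M[R]_n) : M^T = M -> exists X, is_mp_pinv M X.
Proof.
move=> /real_spectral[U [d [U1 ->]]].
(* Since 0^-1 = 0 by convention, this inverts only the nonzero eigenvalues. *)
exists (U *m diag_mx (\row_j (d 0 j)^-1) *m U^T).
have conjM (a b : 'rV[R]_n) : U *m diag_mx a *m U^T *m (U *m diag_mx b *m U^T) =
    U *m diag_mx (\row_j (a 0 j * b 0 j)) *m U^T.
  by rewrite -mulmx_diag !mulmxA -[_ *m U^T *m U]mulmxA U1 mulmx1.
have conjT (a : 'rV[R]_n) : (U *m diag_mx a *m U^T)^T = U *m diag_mx a *m U^T.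
  by rewrite !trmx_mul trmxK tr_diag_mx mulmxA.
rewrite /is_mp_pinv !conjM !conjT.
split=> //; congr (_ *m diag_mx _ *m _); apply/rowP => j; rewrite !mxE.
  by have [->|d0] := eqVneq (d 0 j) 0; rewrite ?mulr0 ?mulfV ?mul1r.
by have [->|d0] := eqVneq (d 0 j) 0; rewrite ?invr0 ?mulr0 ?mulVf ?mul1r.
Qed.

(** The transpose of the pseudoinverse satisfies the Penrose equations of M^T = M, so uniqueness
    makes it symmetric. *)
Lemma sym_mp_pinvP n (M : 'M[R]_n) : M^T = M ->
  is_mp_pinv M (mp_pinv M) /\ (mp_pinv M)^T = mp_pinv M.
Proof.
move=> symM; have pX : is_mp_pinv M (mp_pinv M).
  exact: xgetPex (sym_mp_pinv_exists symM).
split=> //; apply: (mp_pinv_uniq _ pX); case: pX => MXM XMX tMX tXM; split.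
- by rewrite -{1 3}symM -!trmx_mul mulmxA MXM symM.
- by rewrite -[X in _ *m X *m _]symM -!trmx_mul mulmxA XMX.
- by rewrite trmx_mul trmxK symM -tXM trmx_mul symM.
- by rewrite trmx_mul trmxK symM -tMX trmx_mul symM.
Qed.

Section Fixed.
Variables (n k : nat) (A : 'M[R]_n) (Q : 'M[R]_(n, k)).
Hypothesis psdA : psd A.
Local Notation W := (Q^T *m A *m Q).
Local Notation X := (mp_pinv W).
Local Notation N := (nystrom A Q).

Lemma nystromE : N = A *m Q *m X *m (Q^T *m A).
Proof. by rewrite /nystrom trmx_mul psdA.1. Qed.

Lemma psd_nystrom : psd N.
Proof.
have psdW := psd_congr Q psdA.
have [[_ XWX _ _] symX] := sym_mp_pinvP psdW.1.
have -> : N = (X *m (A *m Q)^T)^T *m W *m (X *m (A *m Q)^T).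
  by rewrite /nystrom (trmx_mul X) trmxK symX !mulmxA -[in LHS]XWX !mulmxA.
exact: psd_congr.
Qed.

(** The columns of 1 - X W lie in the kernel of [W], and [Q] maps that kernel into the kernel of
    [A]; hence A Q = A Q X W. *)
Lemma nystrom_mulQ : N *m Q = A *m Q.
Proof.
have psdW := psd_congr Q psdA.
have [[WXW _ _ _] _] := sym_mp_pinvP psdW.1.
have AZ : A *m (Q *m (1%:M - X *m W)) = 0.
  have WZ : W *m (1%:M - X *m W) = 0.
    by rewrite mulmxBr mulmx1 [W *m (X *m W)]mulmxA WXW subrr.
  apply: psd_congr_eq0 => //; rewrite trmx_mul.
  by rewrite -[RHS](mulmx0 _ (1%:M - X *m W)^T) -[in RHS]WZ !mulmxA.
move: AZ; rewrite mulmxBr mulmx1 mulmxBr => /eqP; rewrite subr_eq0 => /eqP ->.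
by rewrite nystromE !mulmxA.
Qed.

Lemma nystrom_quad_le (x : 'cV[R]_n) :
  (x^T *m N *m x) 0 0 <= (x^T *m A *m x) 0 0.
Proof.
have psdW := psd_congr Q psdA.
have [[_ XWX _ _] symX] := sym_mp_pinvP psdW.1.
(* [P] is a projection into the range of [Q], self-adjoint for the form x^T A y, so A P, P^T A and
   P^T A P all equal [N]. *)
pose P := Q *m X *m Q^T *m A.
have PT : P^T = A *m Q *m X *m Q^T.
  by rewrite !trmx_mul trmxK symX psdA.1 !mulmxA.
have AP : A *m P = N by rewrite nystromE /P !mulmxA.
have PTA : P^T *m A = N by rewrite nystromE PT !mulmxA.
have PAP : P^T *m A *m P = N.
  by rewrite PTA nystromE /P !mulmxA -[in RHS]XWX !mulmxA.
have EAN : (1%:M - P)^T *m A *m (1%:M - P) = A - N.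
  have -> : (1%:M - P)^T = 1%:M - P^T by rewrite linearB /= trmx1.
  by rewrite mulmxBr mulmx1 !mulmxBl mul1mx AP PAP PTA subrr subr0.
have := (psd_congr (1%:M - P) psdA).2 x.
by rewrite EAN mulmxBr mulmxBl [X in 0 <= X]mxE [X in _ + X]mxE subr_ge0.
Qed.

End Fixed.

(** Pythagoras: the difference of the two sides is the squared length of u - Q Q^T u. *)
Lemma proj_quad_le n k (Q : 'M[R]_(n, k)) (u : 'cV[R]_n) : Q^T *m Q = 1%:M ->
  ((Q^T *m u)^T *m (Q^T *m u)) 0 0 <= (u^T *m u) 0 0.
Proof.
move=> Q1; have := col_sq_ge0 (u - Q *m (Q^T *m u)).
set y := Q^T *m u.
have -> : (u - Q *m y)^T = u^T - y^T *m Q^T by rewrite linearB /= trmx_mul.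
rewrite mulmxBr !mulmxBl -[y^T *m Q^T *m u]mulmxA -/y.
rewrite -[y^T *m Q^T *m (Q *m y)]mulmxA [Q^T *m (Q *m y)]mulmxA Q1 mul1mx.
have -> : u^T *m (Q *m y) = y^T *m y by rewrite /y trmx_mul trmxK mulmxA.
rewrite subrr subr0.
by rewrite [X in 0 <= X]mxE [X in _ + X]mxE subr_ge0.
Qed.

End Nystrom.

Theorem theorem3p1 (R : realType) (n k : nat)
  (A : 'M[R]_n) (Q : 'M[R]_(n, k)) :
  psd A -> Q^T *m Q = 1%:M -> (k <= n)%N ->
  forall i : nat, (i < k)%N ->
    [/\ lambda (nystrom A Q) i <= lambda A i,
        sing_val (A *m Q) i <= lambda (nystrom A Q) i
      & lambda (Q^T *m A *m Q) i <= sing_val (A *m Q) i].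
Proof.
move=> psdA Q1 kn i ik; have ilt := leq_trans ik kn.
have psdN := psd_nystrom Q psdA; have NQ := nystrom_mulQ Q psdA.
have psdW := psd_congr Q psdA.
set N := nystrom A Q in psdN NQ *.
have symG : ((A *m Q)^T *m (A *m Q))^T = (A *m Q)^T *m (A *m Q).
  by rewrite trmx_mul trmxK.
split.
- apply: (@lambda_compress_le _ _ _ A N 1%:M) => //.
  + exact: psdA.1.
  + exact: psdN.1.
  + by rewrite trmx1 mulmx1.
  by move=> x; rewrite mul1mx nystrom_quad_le.
(* The eigenvalue of [N] becomes the square root of that of N^2, matching the definition of
   [sing_val]. *)
- rewrite -[leRHS]ger0_norm ?psd_lambda_ge0 // -sqrtr_sqr -lambda_sqr //.
  apply: ler_wsqrtr; apply: (@lambda_compress_le _ _ _ (N *m N) _ Q) => //.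
    by rewrite trmx_mul psdN.1.
  by move=> x; rewrite -NQ (trmx_mul N Q) (trmx_mul Q x) psdN.1 !mulmxA.
- rewrite -[leLHS]ger0_norm ?psd_lambda_ge0 // -sqrtr_sqr -lambda_sqr //.
  apply: ler_wsqrtr; apply: (@lambda_compress_le _ _ _ _ _ 1%:M) => //.
  + by rewrite trmx_mul psdW.1.
  + by rewrite trmx1 mulmx1.
  (* The form of W^2 at [x] is the squared length of Q^T (A Q x). *)
  move=> x; rewrite mul1mx; have := proj_quad_le (A *m Q *m x) Q1.
  by rewrite -{1}psdW.1 !trmx_mul !trmxK !mulmxA psdA.1.
Qed.
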